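(* Let $L/\mathbb{Q}_p$ be a finite extension of degree $d$, and let $K\subset\mathbb{C}_p$ be a complete field containing a Galois closure $E$ of $L$. Let $M$ be an $L$-analytic $(\varphi_L,\Gamma_L)$-module over the Robba ring $\mathcal{R}_K$, and let $f\in\operatorname{End}_L(M)$ be an operator that commutes with the action of $\mathfrak{g}_0=E\otimes_{\mathbb{Q}_p}\operatorname{Lie}(\Gamma_L)$ on $M$. Then there is an isomorphism in the derived category $$C^{\bullet}_{f,\mathbb{Q}_p\text{-Lie}}(M)\simeq\bigoplus_{n=0}^{d-1}\Big(C^{\bullet}_{f,L\text{-Lie}}(M)[-n]\Big)^{\binom{d-1}{n}}.$$
   Context: Setting: $\pi_L$ is a uniformiser of $L$ and $\varphi_L\in o_L[[T]]$ is a Frobenius power series for $\pi_L$, with associated Lubin–Tate formal group and multiplication series $[a](T)$, $a\in o_L$. $L_\infty/L$ is the corresponding Lubin–Tate extension, $\Gamma_L=\operatorname{Gal}(L_\infty/L)$, and $\chi_{LT}:\Gamma_L\cong o_L^\times$ is the Lubin–Tate character. $\mathcal{R}_K=\varinjlim_{0<r<1}\mathcal{R}_K^{[r,1)}$ is the Robba ring, where $\mathcal{R}_K^{[r,1)}$ is the Fréchet ring of Laurent series in $T$ over $K$ converging on $r\le|T|<1$; it carries the LF topology, the $K$-linear endomorphism $\varphi_L: T\mapsto\varphi_L(T)$ (for $r$ large, extended to the limit) and the $\Gamma_L$-action $\gamma(T)=[\chi_{LT}(\gamma)](T)$. A $(\varphi_L,\Gamma_L)$-module over $\mathcal{R}_K$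 is a finite free $\mathcal{R}_K$-module $M$ with a continuous semilinear action of $\Gamma_L$ and a $\varphi_L$-semilinear endomorphism $\varphi_M$ commuting with $\Gamma_L$ such that the linearisation $\mathcal{R}_K\otimes_{\mathcal{R}_K,\varphi_L}M\to M$ is an isomorphism. The $\Gamma_L$-action can be differentiated to an action of $\operatorname{Lie}(\Gamma_L)$; $M$ is $L$-analytic if $\operatorname{Lie}(\Gamma_L)\times M\to M$ is $L$-bilinear. Let $\sigma_1=\mathrm{id},\sigma_2,\dots,\sigma_d$ be the embeddings $L\to\mathbb{C}_p$. Identify $\operatorname{Lie}(\Gamma_L)$ with $L$ via the derivative of $\chi_{LT}$. Then $\nabla_1,\dots,\nabla_d$ denotes the $E$-basis of $\mathfrak{g}_0=E\otimes_{\mathbb{Q}_p}\operatorname{Lie}(\Gamma_L)$ such that $\xi\in L\cong\operatorname{Lie}(\Gamma_L)$ equals $\sum_i\sigma_i(\xi)\nabla_i$. $M$ is $L$-analytic if and only if $\nabla_i$ acts as $0$ on $M$ for all $i\ge2$. Regard $M$ as a module over $A=L[x_0,\dots,x_d]$ with $x_0$ acting as $f-1$ and $x_i$ as $\nabla_i$ for $1\le i\le d$. For $x_0,\dots,x_n\in A$ the homological Koszul complex is defined inductively by $K_\bullet(x_0,M)=\operatorname{cone}(M\xrightarrow{x_0}M)$ and $K_\bullet(x_0,\dots,x_n,M)=\operatorname{cone}(K_\bullet(x_0,\dots,x_{n-1},M)\xrightarrow{x_n}K_\bullet(x_0,\dots,x_{n-1},M))$, and the cohomological one is $K^\bullet(x_0,\dots,x_n,M)=\operatorname{Hom}_A(K_\bullet(x_0,\dots,x_n,A),M)$.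 Set $$C^\bullet_{f,L\text{-Lie}}(M)=K^\bullet(x_0,x_1,M),\qquad C^\bullet_{f,\mathbb{Q}_p\text{-Lie}}(M)=K^\bullet(x_0,\dots,x_d,M).$$ These are quasi-isomorphic to $\operatorname{cone}(f-1)[-1]$ on the complexes computing Lie algebra cohomology with values in $M$ of the $L$-Lie algebra $\operatorname{Lie}(\Gamma_L)$, respectively of the $\mathbb{Q}_p$-Lie algebra $\operatorname{Lie}(\Gamma_L)$ (after base change of coefficients). *)

(* Defs.v *)
From HB Require Import structures.
From mathcomp Require Import all_boot all_order all_algebra all_field.
From mathcomp Require Import zify ring lra.
From mathcomp Require Import boolp classical_sets reals.
From mathcomp Require Import ssrcomplements mpoly.

Set Implicit Arguments.
Unset Strict Implicit.
Unset Printing Implicit Defensive.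
Import Order.TTheory GRing.Theory Num.Theory.
Local Open Scope ring_scope.

Record completeField (R : realType) := CompleteField {
  cf_sort :> fieldType;
  absv : cf_sort -> R;
  absv_ge0 : forall x, 0 <= absv x;
  absv_eq0 : forall x, (absv x == 0) = (x == 0);
  absvM : forall x y, absv (x * y) = absv x * absv y;
  absv_ultra : forall x y, absv (x + y) <= Num.max (absv x) (absv y);
  absv_complete : forall u : nat -> cf_sort,
    (forall e, 0 < e -> exists N, forall m n, (N <= m)%N -> (N <= n)%N ->
       absv (u m - u n) < e) ->
    exists l, forall e, 0 < e ->
      exists N, forall n, (N <= n)%N -> absv (u n - l) < e
}.

Section Summation.
Variables (R : realType) (F : completeField R).
Implicit Types (x y : F) (e : R).

Lemma absv0 : absv (0 : F) = 0.
Proof. by apply/eqP; rewrite absv_eq0. Qed.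

Lemma absv1 : absv (1 : F) = 1.
Proof.
have n0 : absv (1 : F) != 0 by rewrite absv_eq0 oner_eq0.
by apply: (mulfI n0); rewrite -absvM !mulr1.
Qed.

Lemma absvN x : absv (- x) = absv x.
Proof.
have h : absv (-1 : F) = 1.
  have /eqP : absv (-1 : F) ^+ 2 = 1 by rewrite expr2 -absvM mulrNN mulr1 absv1.
  rewrite sqrf_eq1 => /orP[/eqP //|/eqP h].
  by have := absv_ge0 (-1 : F); rewrite h ler0N1.
by rewrite -mulN1r absvM h mul1r.
Qed.

Lemma absvB_lt x y e : absv x < e -> absv y < e -> absv (x - y) < e.
Proof.
move=> hx hy; apply: le_lt_trans (absv_ultra _ _) _.
by rewrite absvN gt_max hx hy.
Qed.

Lemma absvD_lt x y e : absv x < e -> absv y < e -> absv (x + y) < e.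
Proof.
move=> hx hy; apply: le_lt_trans (absv_ultra _ _) _.
by rewrite gt_max hx hy.
Qed.

Lemma absv_sum_lt (I : eqType) (s : seq I) (u : I -> F) e : 0 < e ->
  (forall i, i \in s -> absv (u i) < e) -> absv (\sum_(i <- s) u i) < e.
Proof.
move=> e0; elim: s => [|i s IH] h; first by rewrite big_nil absv0.
rewrite big_cons absvD_lt ?h ?mem_head// IH// => j js.
by rewrite h// in_cons js orbT.
Qed.

Definition has_sum (I : eqType) (u : I -> F) x :=
  forall e, 0 < e -> exists s : seq I, forall t : seq I,
    uniq t -> {subset s <= t} -> absv (\sum_(i <- t) u i - x) < e.

Definition null_family (I : eqType) (u : I -> F) :=
  forall e, 0 < e -> exists s : seq I, forall i, i \notin s -> absv (u i) < e.

Lemma absv_small x : (forall e, 0 < e -> absv x < e) -> x = 0.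
Proof.
move=> h; apply/eqP; rewrite -absv_eq0 eq_le absv_ge0 andbT.
by rewrite leNgt; apply/negP => /h; rewrite ltxx.
Qed.

Lemma has_sum_unique (I : eqType) (u : I -> F) x y :
  has_sum u x -> has_sum u y -> x = y.
Proof.
move=> hx hy; apply/eqP; rewrite -subr_eq0; apply/eqP; apply: absv_small => e e0.
have [s hs] := hx _ e0; have [s' hs'] := hy _ e0.
pose t := undup (s ++ s').
have tu : uniq t by rewrite undup_uniq.
have -> : x - y = (\sum_(i <- t) u i - y) - (\sum_(i <- t) u i - x) by ring.
apply: absvB_lt; [apply: hs' => //|apply: hs => //].
  by move=> i si; rewrite mem_undup mem_cat si orbT.
by move=> i si; rewrite mem_undup mem_cat si.
Qed.

Lemma sum_sub (I : eqType) (u : I -> F) (s t : seq I) e : 0 < e ->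
  uniq s -> uniq t -> {subset s <= t} ->
  (forall i, i \notin s -> absv (u i) < e) ->
  absv (\sum_(i <- t) u i - \sum_(i <- s) u i) < e.
Proof.
move=> e0 us ut st h.
have -> : \sum_(i <- s) u i = \sum_(i <- t | i \in s) u i.
  rewrite -[RHS]big_filter; apply: perm_big; apply: uniq_perm => //.
    by rewrite filter_uniq.
  move=> i; rewrite mem_filter; case: (boolP (i \in s)) => //= /st ->//.
rewrite [X in X - _](bigID (fun i => i \in s)) /= addrAC subrr add0r -big_filter.
by apply: absv_sum_lt => // i; rewrite mem_filter => /andP[/h].
Qed.

Lemma has_sum_tail (I : eqType) (u : I -> F) x (s : seq I) e : 0 < e ->
  uniq s -> (forall i, i \notin s -> absv (u i) < e) -> has_sum u x ->
  absv (\sum_(i <- s) u i - x) < e.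
Proof.
move=> e0 us h hx; have [s' hs'] := hx _ e0.
pose t := undup (s ++ s').
have tu : uniq t by rewrite undup_uniq.
have -> : \sum_(i <- s) u i - x = (\sum_(i <- t) u i - x) -
   (\sum_(i <- t) u i - \sum_(i <- s) u i) by ring.
apply: absvB_lt.
  by apply: hs' => // i si; rewrite mem_undup mem_cat si orbT.
by apply: sum_sub => // i si; rewrite mem_undup mem_cat si.
Qed.

Lemma has_sum_lt (I : eqType) (u : I -> F) x e : 0 < e ->
  (forall i, absv (u i) < e) -> has_sum u x -> absv x < e.
Proof.
move=> e0 h hx; rewrite -absvN -[- x]add0r.
by have := @has_sum_tail _ u x [::] e e0 isT (fun i _ => h i) hx; rewrite big_nil.
Qed.

Lemma null_has_sum (I : eqType) (u : I -> F) :
  null_family u -> exists x, has_sum u x.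
Proof.
move=> h.
have h' n : exists s : seq I, forall i, i \notin s -> absv (u i) < n.+1%:R^-1.
  by apply: h; rewrite invr_gt0 ltr0n.
have [S hS] := choice h'.
pose T n := undup (flatten [seq S k | k <- iota 0 n.+1]).
have uT n : uniq (T n) by rewrite undup_uniq.
have ST k n : (k <= n)%N -> {subset S k <= T n}.
  move=> kn i ik; rewrite mem_undup; apply/flattenP; exists (S k) => //.
  by apply: map_f; rewrite mem_iota /= add0n ltnS.
have sT k n i : (k <= n)%N -> i \notin T n -> absv (u i) < k.+1%:R^-1.
  by move=> kn iT; apply: hS; apply: contra iT => /(ST _ _ kn).
have TT m n : (m <= n)%N -> {subset T m <= T n}.
  move=> mn i; rewrite [in X in X -> _]mem_undup => /flattenP[s /mapP[k]].
  by rewrite mem_iota /= add0n ltnS => km ->; exact: ST (leq_trans km mn) _.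
have arch e : 0 < e -> exists N : nat, N.+1%:R^-1 < e.
  move=> e0; exists (Num.bound e^-1).
  rewrite invf_plt ?posrE ?ltr0n//.
  apply: lt_le_trans (archi_boundP _) _; first by rewrite invr_ge0 ltW.
  by rewrite ler_nat.
case: (@absv_complete _ F (fun n => \sum_(i <- T n) u i)) => [e e0|x hx].
  have [N hN] := arch _ e0; exists N => m n Nm Nn.
  have -> : \sum_(i <- T m) u i - \sum_(i <- T n) u i =
     (\sum_(i <- T m) u i - \sum_(i <- T N) u i) -
     (\sum_(i <- T n) u i - \sum_(i <- T N) u i) by ring.
  by apply: absvB_lt; apply: sum_sub => //; try exact: TT;
    move=> i /(sT _ _ _ (leqnn N)) /lt_trans; apply.
exists x => e e0; have [N hN] := arch _ e0; have [N' hN'] := hx _ e0.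
pose M := maxn N N'; exists (T M) => t ut Tt.
have -> : \sum_(i <- t) u i - x = (\sum_(i <- t) u i - \sum_(i <- T M) u i) +
    (\sum_(i <- T M) u i - x) by ring.
apply: absvD_lt; last by apply: hN'; rewrite leq_maxr.
apply: sum_sub => // i /(sT N _ _ (leq_maxl _ _)) /lt_trans; exact.
Qed.

Lemma has_sumD (I : eqType) (u v : I -> F) x y :
  has_sum u x -> has_sum v y -> has_sum (fun i => u i + v i) (x + y).
Proof.
move=> hu hv e e0; have [s hs] := hu _ e0; have [s' hs'] := hv _ e0.
exists (s ++ s') => t ut st; rewrite big_split /=.
have -> : \sum_(i <- t) u i + \sum_(i <- t) v i - (x + y) =
  (\sum_(i <- t) u i - x) + (\sum_(i <- t) v i - y) by ring.
by apply: absvD_lt; [apply: hs|apply: hs'] => // i si; apply: st;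
  rewrite mem_cat si ?orbT.
Qed.

Lemma has_sumZ (I : eqType) (u : I -> F) x c :
  has_sum u x -> has_sum (fun i => c * u i) (c * x).
Proof.
move=> hu e e0; have [->|c0] := eqVneq c 0.
  by exists [::] => t _ _; under eq_bigr do rewrite mul0r;
    rewrite big1_eq mul0r subr0 absv0.
have ac0 : 0 < absv c by rewrite lt_def absv_eq0 c0 absv_ge0.
have [s hs] := hu _ (divr_gt0 e0 ac0).
exists s => t ut st; rewrite -mulr_sumr -mulrBr absvM mulrC.
by rewrite -ltr_pdivlMr// hs.
Qed.

Lemma has_sum_bij (I J : eqType) (h : J -> I) (h' : I -> J) (u : I -> F) x :
  cancel h h' -> cancel h' h -> has_sum u x -> has_sum (u \o h) x.
Proof.
move=> hK h'K hu e e0; have [s hs] := hu _ e0.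
exists (map h' s) => t ut st; rewrite /= -(big_map h xpredT u).
apply: hs; first by rewrite map_inj_uniq //; exact: can_inj hK.
move=> i si; rewrite -[i]h'K; apply: map_f; apply: st; exact: map_f.
Qed.

Lemma has_sum1 (I : eqType) (u : I -> F) i0 :
  (forall i, i != i0 -> u i = 0) -> has_sum u (u i0).
Proof.
move=> h e e0; exists [:: i0] => t ut st.
rewrite (bigD1_seq i0) ?st ?mem_head//= big1 => [|i]; last exact: h.
by rewrite addr0 subrr absv0.
Qed.

Lemma has_sum_ext (I : eqType) (u v : I -> F) x :
  u =1 v -> has_sum u x -> has_sum v x.
Proof. by move=> /funext ->. Qed.

Lemma has_sum_fubini (I J : eqType) (u : I * J -> F) (y : I -> F) x :
  null_family u -> has_sum u x ->
  (forall i, has_sum (fun j => u (i, j)) (y i)) -> has_sum y x.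
Proof.
move=> nu hx hy e e0; have [s0 hs0] := nu _ e0.
pose s := undup s0.
have us : uniq s by rewrite undup_uniq.
have hs p : p \notin s -> absv (u p) < e by rewrite mem_undup; exact: hs0.
exists (map fst s) => t ut st.
pose r i := [seq p <- s | p.1 == i].
have hr i : \sum_(j <- map snd (r i)) u (i, j) = \sum_(p <- s | p.1 == i) u p.
  rewrite big_map big_filter; apply: eq_bigr => -[a b] /= /eqP <- //.
have -> : \sum_(i <- t) y i - x = (\sum_(p <- s) u p - x) -
     (\sum_(i <- t) (\sum_(j <- map snd (r i)) u (i, j) - y i)).
  rewrite sumrB (eq_bigr _ (fun i _ => hr i)).
  have -> : \sum_(i <- t) \sum_(p <- s | p.1 == i) u p = \sum_(p <- s) u p.
    under eq_bigr do rewrite big_mkcond.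
    rewrite exchange_big /= big_seq [RHS]big_seq; apply: eq_bigr => p ps.
    rewrite (bigD1_seq p.1) ?eqxx//=; last by apply: st; exact: map_f.
    by rewrite big1 ?addr0// => i; rewrite eq_sym => /negbTE ->.
  ring.
apply: absvB_lt; first exact: has_sum_tail.
apply: absv_sum_lt => // i _; apply: has_sum_tail => //.
  rewrite map_inj_in_uniq ?filter_uniq// => -[a b] [a' b'].
  by rewrite !mem_filter /= => /andP[/eqP -> _] /andP[/eqP -> _] ->.
move=> j jr; apply: hs; apply: contra jr => ijs.
by apply/mapP; exists (i, j); rewrite ?mem_filter /= ?eqxx.
Qed.

End Summation.

Section SumValue.
Variables (R : realType) (F : completeField R).

Definition sum_of (I : eqType) (u : I -> F) : F := xget 0 [set x | has_sum u x]%classic.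

Lemma sum_ofE (I : eqType) (u : I -> F) x : has_sum u x -> sum_of u = x.
Proof.
move=> h; rewrite /sum_of; case: xgetP => [y _ hy|/(_ _ h)//].
exact: has_sum_unique hy h.
Qed.

Lemma sum_ofP (I : eqType) (u : I -> F) : null_family u -> has_sum u (sum_of u).
Proof. by case/null_has_sum => x hx; rewrite (sum_ofE hx). Qed.

End SumValue.

Section Robba.
Variables (R : realType) (K : completeField R).
Implicit Types (r s : R) (a b c : int -> K) (m n : int).

Definition conv_at s a := forall e, 0 < e ->
  exists N : nat, forall n, (N < `|n|)%N -> absv (a n) * s ^ n < e.

(* [a] belongs to the ring of Laurent series converging on [r <= |T| < 1]. *)
Definition annulus r a := forall s, r <= s -> s < 1 -> conv_at s a.

Record robba := Robba {
  coef : int -> K;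
  coefP : exists r, [/\ 0 < r, r < 1 & annulus r coef]
}.

Lemma robba_eq (f g : robba) : coef f =1 coef g -> f = g.
Proof.
case: f g => [f pf] [g pg] /= /funext fg; case: _ / fg pg => pg.
by rewrite (Prop_irrelevance pf pg).
Qed.

HB.instance Definition _ := gen_eqMixin robba.
HB.instance Definition _ := gen_choiceMixin robba.

Lemma annulus_max r r' a : annulus r a -> annulus (Num.max r r') a.
Proof. by move=> h s; rewrite ge_max => /andP[rs _]; apply: h. Qed.

Lemma robba_common (f g : robba) :
  exists r, [/\ 0 < r, r < 1, annulus r (coef f) & annulus r (coef g)].
Proof.
have [r [r0 r1 rf]] := coefP f; have [r' [r'0 r'1 r'g]] := coefP g.
exists (Num.max r r'); split; rewrite ?lt_max ?r0 ?gt_max ?r1//.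
  exact: annulus_max.
by rewrite maxC; exact: annulus_max.
Qed.

Lemma absvX0 s n : 0 < s -> 0 < s ^ n.
Proof. by move=> s0; rewrite exprz_gt0. Qed.

Lemma weight_ge0 s a n : 0 < s -> 0 <= absv (a n) * s ^ n.
Proof. by move=> s0; rewrite mulr_ge0 ?absv_ge0// ltW// absvX0. Qed.

Definition box (N : nat) : seq int := [seq k%:Z - N%:Z | k <- iota 0 (N.*2.+1)].

Lemma mem_box N n : (n \in box N) = (`|n| <= N)%N.
Proof.
apply/idP/idP => [/mapP[k]|h]; first by rewrite mem_iota => h ->; lia.
by apply/mapP; exists (absz (n + N%:Z)); rewrite ?mem_iota; lia.
Qed.

Lemma conv_at_bound s a : 0 < s -> conv_at s a ->
  exists2 A, 0 < A & forall n, absv (a n) * s ^ n < A.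
Proof.
move=> s0 /(_ 1 ltr01)[N hN].
pose A := \sum_(k <- box N) absv (a k) * s ^ k + 1.
have S0 : 0 <= \sum_(k <- box N) absv (a k) * s ^ k.
  by apply: sumr_ge0 => i _; exact: weight_ge0.
exists A => [|n]; first by rewrite ltr_wpDl.
case: (boolP (n \in box N)) => [nb|]; last first.
  by rewrite mem_box -ltnNge => /hN h; apply: lt_le_trans h _; rewrite lerDr.
rewrite ltr_pwDr// (big_rem n)//= lerDl.
by apply: sumr_ge0 => i _; exact: weight_ge0.
Qed.

Lemma lt_mulC (x y A e : R) : 0 < A -> 0 <= x -> 0 <= y ->
  x < A -> y < e / A -> x * y < e.
Proof.
move=> A0 x0 y0 xA ye; have [->|xn0] := eqVneq x 0.
  rewrite mul0r -(@pmulr_lgt0 _ A^-1) ?invr_gt0//.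
  exact: le_lt_trans ye.
apply: le_lt_trans (_ : A * y < _); first by rewrite ler_wpM2r// ltW.
by rewrite mulrC -ltr_pdivlMr.
Qed.

Lemma weightM s a b k n : s != 0 ->
  absv (a k * b (n - k)) * s ^ n =
  (absv (a k) * s ^ k) * (absv (b (n - k)) * s ^ (n - k)).
Proof.
move=> s0; rewrite absvM -[in s ^ n](subrKC k n) expfzDr//; ring.
Qed.

Lemma weightM_small s a b : 0 < s -> conv_at s a -> conv_at s b ->
  forall e, 0 < e -> exists N : nat, forall k l,
    (N < `|k|)%N || (N < `|l|)%N ->
    (absv (a k) * s ^ k) * (absv (b l) * s ^ l) < e.
Proof.
move=> s0 ca cb e e0.
have [A A0 hA] := conv_at_bound s0 ca; have [B B0 hB] := conv_at_bound s0 cb.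
have [N hN] := ca _ (divr_gt0 e0 B0); have [N' hN'] := cb _ (divr_gt0 e0 A0).
exists (maxn N N') => k l /orP[]; rewrite gtn_max => /andP[h h'].
  by rewrite mulrC; apply: lt_mulC B0 _ _ _ (hN _ h) => //; exact: weight_ge0.
by apply: lt_mulC A0 _ _ _ (hN' _ h') => //; exact: weight_ge0.
Qed.

Lemma null_mul s a b n : 0 < s -> conv_at s a -> conv_at s b ->
  null_family (fun k => a k * b (n - k)).
Proof.
move=> s0 ca cb e e0; have sn := lt0r_neq0 s0.
have [N hN] := weightM_small s0 ca cb (mulr_gt0 e0 (absvX0 n s0)).
exists (box N) => k; rewrite mem_box -ltnNge => hk.
by rewrite -(ltr_pM2r (absvX0 n s0)) weightM// hN// hk.
Qed.

Definition laurent_mul a b n : K := sum_of (fun k => a k * b (n - k)).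

Lemma laurent_mul_conv s a b : 0 < s -> conv_at s a -> conv_at s b ->
  conv_at s (laurent_mul a b).
Proof.
move=> s0 ca cb e e0; have sn := lt0r_neq0 s0.
have [N hN] := weightM_small s0 ca cb e0.
exists (N + N)%N => n hn.
rewrite -ltr_pdivlMr ?absvX0//.
apply: (has_sum_lt _ _ (sum_ofP (null_mul n s0 ca cb))).
  by rewrite divr_gt0 ?absvX0.
by move=> k; rewrite ltr_pdivlMr ?absvX0// weightM// hN//; lia.
Qed.

Lemma annulusM r a b : 0 < r -> annulus r a -> annulus r b ->
  annulus r (laurent_mul a b).
Proof.
move=> r0 ha hb s rs s1; apply: laurent_mul_conv.
- exact: lt_le_trans rs.
- exact: ha.
- exact: hb.
Qed.

Lemma annulusD r a b : 0 < r -> annulus r a -> annulus r b ->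
  annulus r (fun n => a n + b n).
Proof.
move=> r0 ha hb s rs s1 e e0; have s0 := lt_le_trans r0 rs.
have [N hN] := ha s rs s1 _ e0; have [N' hN'] := hb s rs s1 _ e0.
exists (maxn N N') => n; rewrite gtn_max => /andP[h h'].
rewrite -ltr_pdivlMr ?absvX0//; apply: absvD_lt.
  by rewrite ltr_pdivlMr ?absvX0// hN.
by rewrite ltr_pdivlMr ?absvX0// hN'.
Qed.

Lemma annulus_fin r a (N : nat) :
  (forall n, (N < `|n|)%N -> a n = 0) -> annulus r a.
Proof.
move=> h s _ _ e e0; exists N => n /h ->.
by rewrite absv0 mul0r.
Qed.

Lemma robba_finP a (N : nat) : (forall n, (N < `|n|)%N -> a n = 0) ->
  exists r, [/\ 0 < r, r < 1 & annulus r a].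
Proof.
move=> h; exists (2%:R^-1); split; last exact: annulus_fin h.
  by rewrite invr_gt0 ltr0n.
by rewrite invf_lt1 ?ltr1n ?ltr0n.
Qed.

Lemma robba_addP (f g : robba) : exists r,
  [/\ 0 < r, r < 1 & annulus r (fun n => coef f n + coef g n)].
Proof.
by have [r [r0 r1 hf hg]] := robba_common f g; exists r; split=> //; apply: annulusD.
Qed.

Lemma robba_oppP (f : robba) : exists r,
  [/\ 0 < r, r < 1 & annulus r (fun n => - coef f n)].
Proof.
have [r [r0 r1 hf]] := coefP f; exists r; split=> // s rs s1 e e0.
have [N hN] := hf s rs s1 e e0; exists N => n /hN; by rewrite absvN.
Qed.

Lemma robba_mulP (f g : robba) : exists r,
  [/\ 0 < r, r < 1 & annulus r (laurent_mul (coef f) (coef g))].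
Proof.
by have [r [r0 r1 hf hg]] := robba_common f g; exists r; split=> //; apply: annulusM.
Qed.

Lemma monomialP (c : K) (m : int) : exists r,
  [/\ 0 < r, r < 1 & annulus r (fun n => c *+ (n == m))].
Proof.
apply: (@robba_finP _ `|m|%N) => n; have [-> |//] := eqVneq n m.
by rewrite ltnn.
Qed.

Definition robba_monomial (c : K) (m : int) : robba := Robba (monomialP c m).

Definition robba0 : robba := robba_monomial 0 0.
Definition robba1 : robba := robba_monomial 1 0.
Definition robba_add (f g : robba) : robba := Robba (robba_addP f g).
Definition robba_opp (f : robba) : robba := Robba (robba_oppP f).
Definition robba_mul (f g : robba) : robba := Robba (robba_mulP f g).

Fact robba_addA : associative robba_add.
Proof. by move=> f g h; apply: robba_eq => n /=; rewrite addrA. Qed.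
Fact robba_addC : commutative robba_add.
Proof. by move=> f g; apply: robba_eq => n /=; rewrite addrC. Qed.
Fact robba_add0 : left_id robba0 robba_add.
Proof. by move=> f; apply: robba_eq => n /=; rewrite mul0rn add0r. Qed.
Fact robba_addN : left_inverse robba0 robba_opp robba_add.
Proof. by move=> f; apply: robba_eq => n /=; rewrite mul0rn addNr. Qed.

HB.instance Definition _ :=
  GRing.isZmodule.Build robba robba_addA robba_addC robba_add0 robba_addN.

Lemma robba_conv2 (f g : robba) :
  exists s, [/\ 0 < s, conv_at s (coef f) & conv_at s (coef g)].
Proof.
have [r [r0 r1 hf hg]] := robba_common f g.
by exists r; split => //; [apply: hf|apply: hg].
Qed.

Lemma has_sum_coefM (f g : robba) n :
  has_sum (fun k => coef f k * coef g (n - k)) (coef (robba_mul f g) n).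
Proof.
have [s [s0 hf hg]] := robba_conv2 f g.
apply: sum_ofP; exact: null_mul hf hg.
Qed.

Fact robba_mulC : commutative robba_mul.
Proof.
move=> f g; apply: robba_eq => n /=; apply: sum_ofE.
have h : cancel (fun k => n - k) (fun k => n - k) by move=> k; rewrite subKr.
apply: has_sum_ext (has_sum_bij h h (has_sum_coefM g f n)) => k /=.
by rewrite subKr mulrC.
Qed.

Fact robba_mulDl : left_distributive robba_mul robba_add.
Proof.
move=> f g h; apply: robba_eq => n /=; apply: sum_ofE.
apply: has_sum_ext (has_sumD (has_sum_coefM f h n) (has_sum_coefM g h n)) => k /=.
by rewrite mulrDl.
Qed.

Lemma coef_monomialM (c : K) m (f : robba) n :
  coef (robba_mul (robba_monomial c m) f) n = c * coef f (n - m).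
Proof.
apply: sum_ofE => /=.
have := @has_sum1 R K _ (fun k => c *+ (k == m) * coef f (n - k)) m.
rewrite eqxx mulr1n; apply=> k /negbTE ->.
by rewrite mulr0n mul0r.
Qed.

Fact robba_mul1 : left_id robba1 robba_mul.
Proof.
by move=> f; apply: robba_eq => n; rewrite coef_monomialM mul1r subr0.
Qed.

Fact robba_mulA : associative robba_mul.
Proof.
move=> f g h; apply: robba_eq => n.
have [r [r0 r1 hf hg]] := robba_common f g.
have [r' [r'0 r'1 hh]] := coefP h.
pose s := Num.max r r'.
have s0 : 0 < s by rewrite lt_max r0.
have s1 : s < 1 by rewrite gt_max r1.
have cf : conv_at s (coef f) by apply: (@annulus_max r r' _ hf).
have cg : conv_at s (coef g) by apply: (@annulus_max r r' _ hg).
have ch : conv_at s (coef h) by apply: hh => //; rewrite le_max lexx orbT.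
have sn0 := lt0r_neq0 s0.
pose u (p : int * int) : K := coef f p.1 * (coef g p.2 * coef h (n - p.1 - p.2)).
have nu : null_family u.
  move=> e e0.
  have [A A0 hA] := conv_at_bound s0 ch.
  have [N hN] := weightM_small s0 cf cg (divr_gt0 (mulr_gt0 e0 (absvX0 n s0)) A0).
  exists [seq (k, l) | k <- box N, l <- box N] => -[k l] kl.
  rewrite -(ltr_pM2r (absvX0 n s0)) /u /= !absvM.
  have sE : s ^ n = s ^ k * s ^ l * s ^ (n - k - l).
    by rewrite -!expfzDr//; congr (_ ^ _); ring.
  rewrite [X in X < _](_ : _ = (absv (coef h (n - k - l)) * s ^ (n - k - l)) *
     ((absv (coef f k) * s ^ k) * (absv (coef g l) * s ^ l))); last first.
    by rewrite sE; ring.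
  apply: (lt_mulC A0 _ _ (hA _)); rewrite ?mulr_ge0 ?absv_ge0 ?(ltW (absvX0 _ s0))//.
  apply: hN; rewrite !ltnNge -negb_and -!mem_box; apply: contra kl => /andP[kb lb].
  by apply: allpairs_f.
have [x hx] := null_has_sum nu.
transitivity x; [|symmetry]; apply: sum_ofE.
  apply: (has_sum_fubini nu hx) => k.
  by apply: has_sum_ext (has_sumZ (coef f k) (has_sum_coefM g h (n - k))) => l.
pose sw (p : int * int) : int * int := (p.2, p.1 - p.2).
pose sw' (p : int * int) : int * int := (p.1 + p.2, p.1).
have swK : cancel sw sw' by case=> a b; rewrite /sw /sw' /= subrKC.
have sw'K : cancel sw' sw by case=> a b; rewrite /sw /sw' /= addrAC subrr add0r.
have hx' := has_sum_bij swK sw'K hx.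
have nu' : null_family (u \o sw).
  move=> e e0; have [S hS] := nu e e0; exists (map sw' S) => p ps.
  by apply: hS; apply: contra ps => ps; rewrite -[p]swK map_f.
apply: (has_sum_fubini nu' hx') => m.
rewrite mulrC.
apply: has_sum_ext (has_sumZ (coef h (n - m)) (has_sum_coefM f g m)) => k.
rewrite /u /sw /=; have -> : n - k - (m - k) = n - m by ring.
by ring.
Qed.

Fact robba_1_neq0 : robba1 != 0.
Proof.
apply/negP => /eqP /(congr1 (fun f => coef f 0)) /= /eqP.
by rewrite mul0rn mulr1n oner_eq0.
Qed.

HB.instance Definition _ := GRing.Zmodule_isComNzRing.Build robba
  robba_mulA robba_mulC robba_mul1 robba_mulDl robba_1_neq0.

Definition robbaC (c : K) : robba := robba_monomial c 0.

Definition robbaT : robba := robba_monomial 1 1.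

Fact robbaC_zmod : zmod_morphism robbaC.
Proof. by move=> c c'; apply: robba_eq => n /=; rewrite mulrnBl. Qed.

Fact robbaC_monoid : monoid_morphism robbaC.
Proof.
split=> // c c'; apply: robba_eq => n; rewrite [RHS]coef_monomialM /=.
by rewrite subr0 mulrnAr.
Qed.

HB.instance Definition _ := GRing.isZmodMorphism.Build K robba robbaC robbaC_zmod.
HB.instance Definition _ :=
  GRing.isMonoidMorphism.Build K robba robbaC robbaC_monoid.

End Robba.

Section Complexes.
Variable A : comNzRingType.

(* Cochain complexes indexed by [int].  The differential is indexed by a proof
   of [i + 1 = j], so that shifts need no transport.  Homological complexes are
   read as cochain complexes in the usual way: the object in homological
   degree [n] is placed in degree [- n]. *)
Record complex := Complex {
  ob :> int -> lmodType A;
  df : forall i j : int, i + 1 = j -> {linear ob i -> ob j};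
  df_df : forall (i j k : int) (e : i + 1 = j) (e' : j + 1 = k) x,
    df e' (df e x) = 0
}.

Record cmor (X Y : complex) := CMor {
  mor :> forall i, {linear X i -> Y i};
  morP : forall (i j : int) (e : i + 1 = j) x, mor j (df X e x) = df Y e (mor i x)
}.

Definition cmor_id (X : complex) : cmor X X :=
  @CMor X X (fun i => idfun) (fun i j e x => erefl).

Lemma cmor_comp_subproof (X Y Z : complex) (g : cmor Y Z) (f : cmor X Y)
  (i j : int) (e : i + 1 = j) x :
  (g j \o f j) (df X e x) = df Z e ((g i \o f i) x).
Proof. by rewrite /= !morP. Qed.

Definition cmor_comp (X Y Z : complex) (g : cmor Y Z) (f : cmor X Y) : cmor X Z :=
  @CMor X Z (fun i => g i \o f i) (cmor_comp_subproof g f).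

(* [f] induces an isomorphism (injective, surjective) on every [H^j]. *)
Definition quasi_iso (X Y : complex) (f : cmor X Y) :=
  forall (i j k : int) (e : i + 1 = j) (e' : j + 1 = k),
    (forall x : X j, df X e' x = 0 ->
       (exists y, f j x = df Y e y) -> exists x', x = df X e x') /\
    (forall y : Y j, df Y e' y = 0 ->
       exists2 x, df X e' x = 0 & exists y', f j x - y = df Y e y').

(* The derived category: the localisation of the category of complexes at the
   quasi-isomorphisms.  Its morphisms are words in morphisms of complexes and
   formal inverses of quasi-isomorphisms, modulo [deq]. *)
Inductive dmor : complex -> complex -> Type :=
| dmap X Y (f : cmor X Y) : dmor X Y
| dinv X Y (w : cmor X Y) (qw : quasi_iso w) : dmor Y X
| dcomp X Y Z (v : dmor Y Z) (u : dmor X Y) : dmor X Z.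

Definition did (X : complex) : dmor X X := dmap (cmor_id X).

Inductive deq : forall X Y, dmor X Y -> dmor X Y -> Prop :=
| deq_refl X Y (u : dmor X Y) : deq u u
| deq_sym X Y (u v : dmor X Y) : deq u v -> deq v u
| deq_trans X Y (u v w : dmor X Y) : deq u v -> deq v w -> deq u w
| deq_comp X Y Z (v v' : dmor Y Z) (u u' : dmor X Y) :
    deq v v' -> deq u u' -> deq (dcomp v u) (dcomp v' u')
| deq_assoc X Y Z W (w : dmor Z W) (v : dmor Y Z) (u : dmor X Y) :
    deq (dcomp w (dcomp v u)) (dcomp (dcomp w v) u)
| deq_idl X Y (u : dmor X Y) : deq (dcomp (did Y) u) u
| deq_idr X Y (u : dmor X Y) : deq (dcomp u (did X)) u
| deq_ext X Y (f g : cmor X Y) : (forall i, f i =1 g i) -> deq (dmap f) (dmap g)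
| deq_map X Y Z (g : cmor Y Z) (f : cmor X Y) :
    deq (dmap (cmor_comp g f)) (dcomp (dmap g) (dmap f))
| deq_invl X Y (w : cmor X Y) (qw : quasi_iso w) :
    deq (dcomp (dinv qw) (dmap w)) (did X)
| deq_invr X Y (w : cmor X Y) (qw : quasi_iso w) :
    deq (dcomp (dmap w) (dinv qw)) (did Y).

Definition derived_iso (X Y : complex) := exists (u : dmor X Y) (v : dmor Y X),
  deq (dcomp v u) (did X) /\ deq (dcomp u v) (did Y).

Definition zeroM : lmodType A := 'rV[A]_0.

Definition complex0 : complex :=
  @Complex (fun=> zeroM) (fun _ _ _ => \0) (fun _ _ _ _ _ _ => erefl).

Section Dsum.
Variables X Y : complex.

Definition dsum_df (i j : int) (e : i + 1 = j) (x : (X i * Y i)%type) :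
  (X j * Y j)%type := (df X e x.1, df Y e x.2).

Fact dsum_df_linear i j e : linear (@dsum_df i j e).
Proof. by move=> a x y; rewrite /dsum_df !linearP. Qed.

HB.instance Definition _ i j e :=
  GRing.isLinear.Build A (X i * Y i)%type (X j * Y j)%type _ (@dsum_df i j e)
    (dsum_df_linear e).

Fact dsum_df_df (i j k : int) (e : i + 1 = j) (e' : j + 1 = k) x :
  dsum_df e' (dsum_df e x) = 0.
Proof. by rewrite /dsum_df /= !df_df. Qed.

Definition dsum : complex :=
  @Complex (fun i => X i * Y i)%type (fun i j e => dsum_df e) dsum_df_df.

End Dsum.

Section Shift.
Variables (X : complex) (m : int).

Fact shift_eq (i j : int) : i + 1 = j -> (i + m) + 1 = j + m.
Proof. by move=> <-; rewrite addrAC. Qed.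

Fact shift_df_df (i j k : int) (e : i + 1 = j) (e' : j + 1 = k) x :
  ((-1) ^+ `|m| \*: df X (shift_eq e'))
    (((-1) ^+ `|m| \*: df X (shift_eq e)) x) = 0.
Proof. by rewrite /= linearZ /= df_df !scaler0. Qed.

Definition shift : complex :=
  @Complex (fun i => X (i + m))
    (fun i j e => (-1) ^+ `|m| \*: df X (shift_eq e)) shift_df_df.

End Shift.

Section Cone.
Variables (X Y : complex) (f : cmor X Y).

Definition cone_df (i j : int) (e : i + 1 = j) :
  (X (i + 1)%R * Y i)%type -> (X (j + 1)%R * Y j)%type :=
  match e in _ = j return (X (i + 1)%R * Y i)%type -> (X (j + 1)%R * Y j)%type with
  | erefl => fun x =>
      (- df X (erefl _) x.1,
       f (i + 1) x.1 + df Y (erefl _) x.2)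
  end.

Fact cone_df_linear i j e : linear (@cone_df i j e).
Proof.
case: j / e => a x y /=; rewrite !linearP; congr (_, _) => //=.
by rewrite scalerDr addrACA.
Qed.

HB.instance Definition _ i j e :=
  GRing.isLinear.Build A (X (i + 1)%R * Y i)%type (X (j + 1)%R * Y j)%type _
    (@cone_df i j e) (cone_df_linear e).

Fact cone_df_df (i j k : int) (e : i + 1 = j) (e' : j + 1 = k) x :
  cone_df e' (cone_df e x) = 0.
Proof.
case: k / e'; case: j / e => /=.
rewrite linearD !linearN /= !df_df !oppr0 addr0 morP addNr; exact: erefl.
Qed.

Definition cone : complex :=
  @Complex (fun i => X (i + 1)%R * Y i)%type (fun i j e => cone_df e) cone_df_df.

End Cone.

Definition single (M : lmodType A) : complex :=
  @Complex (fun i => if i is Posz 0 then M else zeroM)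
    (fun _ _ _ => \0) (fun _ _ _ _ _ _ => erefl).

Fact cscale_subproof (a : A) (X : complex) (i j : int) (e : i + 1 = j) (x : X i) :
  (a \*: idfun) (df X e x) = df X e ((a \*: idfun) x).
Proof. by rewrite /= linearZ. Qed.

Definition cscale (a : A) (X : complex) : cmor X X :=
  @CMor X X (fun i => a \*: idfun) (@cscale_subproof a X).

(* [K_.(x_0, ..., x_n, M)] *)
Definition koszul (s : seq A) (M : lmodType A) : complex :=
  foldl (fun X a => cone (cscale a X)) (single M) s.

Section HomModule.
Variables U V : lmodType A.

Record hom := Hom { hom_fun :> U -> V; hom_linear : linear hom_fun }.

Lemma hom_eq (f g : hom) : f =1 g -> f = g.
Proof.
case: f g => [f pf] [g pg] /= /funext fg; case: _ / fg pg => pg.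
by rewrite (Prop_irrelevance pf pg).
Qed.

HB.instance Definition _ := gen_eqMixin hom.
HB.instance Definition _ := gen_choiceMixin hom.

Fact hom0P : linear (fun _ : U => 0 : V).
Proof. by move=> a x y; rewrite scaler0 addr0. Qed.
Fact homDP (f g : hom) : linear (fun x => f x + g x).
Proof. by move=> a x y; rewrite !hom_linear scalerDr addrACA. Qed.
Fact homNP (f : hom) : linear (fun x => - f x).
Proof. by move=> a x y; rewrite hom_linear opprD scalerN. Qed.
Fact homZP (b : A) (f : hom) : linear (fun x => b *: f x).
Proof. by move=> a x y; rewrite hom_linear scalerDr !scalerA mulrC. Qed.

Definition hom0 := Hom hom0P.
Definition homD f g := Hom (homDP f g).
Definition homN f := Hom (homNP f).
Definition homZ b f := Hom (homZP b f).

Fact homDA : associative homD.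
Proof. by move=> f g h; apply: hom_eq => x /=; rewrite addrA. Qed.
Fact homDC : commutative homD.
Proof. by move=> f g; apply: hom_eq => x /=; rewrite addrC. Qed.
Fact hom0D : left_id hom0 homD.
Proof. by move=> f; apply: hom_eq => x /=; rewrite add0r. Qed.
Fact homND : left_inverse hom0 homN homD.
Proof. by move=> f; apply: hom_eq => x /=; rewrite addNr. Qed.

HB.instance Definition _ := GRing.isZmodule.Build hom homDA homDC hom0D homND.

Fact homZA a b f : homZ a (homZ b f) = homZ (a * b) f.
Proof. by apply: hom_eq => x /=; rewrite scalerA. Qed.
Fact hom1Z : left_id 1 homZ.
Proof. by move=> f; apply: hom_eq => x /=; rewrite scale1r. Qed.
Fact homZDr : right_distributive homZ +%R.
Proof. by move=> a f g; apply: hom_eq => x /=; rewrite scalerDr. Qed.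
Fact homZDl f : {morph homZ^~ f : a b / a + b}.
Proof. by move=> a b; apply: hom_eq => x /=; rewrite scalerDl. Qed.

HB.instance Definition _ :=
  GRing.Zmodule_isLmodule.Build A hom homZA hom1Z homZDr homZDl.

End HomModule.

Section HomComplex.
Variables (X : complex) (M : lmodType A).

Fact hom_eqi (i j : int) : i + 1 = j -> - j + 1 = - i.
Proof. by move=> <-; rewrite opprD addrNK. Qed.

Fact hom_df_subproof (i j : int) (e : i + 1 = j) (h : hom (X (- i)) M) :
  linear (fun x => h (df X (hom_eqi e) x)).
Proof. by move=> a x y; rewrite linearP hom_linear. Qed.

Definition hom_df (i j : int) (e : i + 1 = j) (h : hom (X (- i)) M) :
  hom (X (- j)) M := Hom (hom_df_subproof e h).

Fact hom_df_linear i j e : linear (@hom_df i j e).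
Proof. by move=> a f g; apply: hom_eq. Qed.

HB.instance Definition _ i j e :=
  GRing.isLinear.Build A (hom (X (- i)) M) (hom (X (- j)) M) _
    (@hom_df i j e) (hom_df_linear e).

Fact hom_df_df (i j k : int) (e : i + 1 = j) (e' : j + 1 = k) h :
  hom_df e' (hom_df e h) = 0.
Proof.
apply: hom_eq => x /=; rewrite df_df.
by have := hom_linear h (- 1) 0 0; rewrite scaler0 addr0 scaleN1r addNr.
Qed.

(* [Hom_A(X, M)], with [Hom_A(X_n, M)] in degree [n] *)
Definition homC : complex :=
  @Complex (fun i => hom (X (- i)) M) (fun i j e => hom_df e) hom_df_df.

End HomComplex.

(* [K^.(x_0, ..., x_n, M)] *)
Definition koszul_coh (s : seq A) (M : lmodType A) : complex :=
  homC (koszul s A^o) M.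

End Complexes.

Arguments complex0 {A}.

(* [M] seen as an [F]-module through [h : F -> S]. *)
Definition resMod (F S : pzRingType) (h : {rmorphism F -> S}) (M : lmodType S)
  : Type := M.

Section ResMod.
Variables (F S : pzRingType) (h : {rmorphism F -> S}) (M : lmodType S).

HB.instance Definition _ := GRing.Zmodule.on (resMod h M).

Definition res_scale (a : F) (m : resMod h M) : resMod h M := h a *: (m : M).

Fact res_scaleA a b m : res_scale a (res_scale b m) = res_scale (a * b) m.
Proof. by rewrite /res_scale scalerA rmorphM. Qed.
Fact res_scale1 : left_id 1 res_scale.
Proof. by move=> m; rewrite /res_scale rmorph1 scale1r. Qed.
Fact res_scaleDr : right_distributive res_scale +%R.
Proof. by move=> a x y; rewrite /res_scale scalerDr. Qed.
Fact res_scaleDl m : {morph res_scale^~ m : a b / a + b}.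
Proof. by move=> a b; rewrite /res_scale rmorphD scalerDl. Qed.

HB.instance Definition _ := GRing.Zmodule_isLmodule.Build F (resMod h M)
  res_scaleA res_scale1 res_scaleDr res_scaleDl.

End ResMod.

(* [V] seen as an [F[x_0, ..., x_(n-1)]]-module, ['X_i] acting as [x i]. *)
Definition opMod (F : fieldType) (V : lmodType F) (n : nat) (x : 'I_n -> V -> V)
  (x_linear : forall i, linear (x i))
  (x_comm : forall i j v, x i (x j v) = x j (x i v)) : Type := V.

Section OpMod.
Variables (F : fieldType) (V : lmodType F) (n : nat) (x : 'I_n -> V -> V).
Hypothesis x_linear : forall i, linear (x i).
Hypothesis x_comm : forall i j v, x i (x j v) = x j (x i v).
Implicit Types (mu nu : 'X_{1..n}) (v w : V) (P Q : {mpoly F[n]}).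

Definition mon_act mu v : V := foldr (fun i w => iter (mu i) (x i) w) v (enum 'I_n).

Lemma iter_x_linear i k : linear (iter k (x i)).
Proof. by elim: k => [|k IH] a v w //=; rewrite IH x_linear. Qed.

Lemma mon_act_linear mu : linear (mon_act mu).
Proof.
rewrite /mon_act; elim: (enum _) => [|i s IH] a v w //=.
by rewrite IH iter_x_linear.
Qed.

HB.instance Definition _ mu :=
  GRing.isLinear.Build F V V _ (mon_act mu) (mon_act_linear mu).

Lemma iter_x_comm i j k l v :
  iter k (x i) (iter l (x j) v) = iter l (x j) (iter k (x i) v).
Proof.
have h w : x i (iter l (x j) w) = iter l (x j) (x i w).
  by elim: l => //= l IH; rewrite x_comm IH.
by elim: k => //= k IH; rewrite IH h.
Qed.

Lemma mon_actD mu nu v : mon_act (mu + nu) v = mon_act mu (mon_act nu v).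
Proof.
rewrite /mon_act; elim: (enum _) => //= i s ->.
rewrite mnmDE iterD; congr iter; move: (foldr _ v s) => w.
by elim: s => //= j s <-; rewrite iter_x_comm.
Qed.

Lemma mon_act0 v : mon_act 0 v = v.
Proof.
by rewrite /mon_act; elim: (enum _) => //= i s ->; rewrite mnm0E.
Qed.

Lemma mon_actU i v : mon_act U_(i) v = x i v.
Proof.
rewrite /mon_act.
have h s : i \notin s -> foldr (fun j w => iter (U_(i)%MM j) (x j) w) v s = v.
  by elim: s => //= j s IH; rewrite in_cons negb_or mnm1E => /andP[/negbTE -> /IH ->].
have : i \in enum 'I_n by rewrite mem_enum.
have := enum_uniq 'I_n.
elim: (enum 'I_n) => //= j s IH /andP[js us]; rewrite in_cons mnm1E.
have [ij|ij] /= := eqVneq i j; last exact: IH.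
by move=> _; rewrite h ij.
Qed.

Definition op_scale P v : V := \sum_(mu <- msupp P) P@_mu *: mon_act mu v.

Lemma op_scaleE P v k : (msize P <= k)%N ->
  op_scale P v = \sum_(mu : 'X_{1..n < k}) P@_mu *: mon_act mu v.
Proof.
move=> le_k; set I : subFinType _ := 'X_{1..n < k}.
rewrite /op_scale (big_mksub I) ?msupp_uniq //=; first last.
  by move=> mu /msize_mdeg_lt /leq_trans; apply.
rewrite big_rmcond //= => mu /memN_msupp_eq0 ->.
by rewrite scale0r.
Qed.

Lemma op_scaleDl v : {morph op_scale^~ v : P Q / P + Q}.
Proof.
move=> P Q; pose k := maxn (msize (P + Q)) (maxn (msize P) (msize Q)).
rewrite !(@op_scaleE _ _ k) ?leq_max ?leqnn ?orbT//.
rewrite -big_split; apply: eq_bigr => mu _ /=.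
by rewrite mcoeffD scalerDl.
Qed.

Lemma op_scaleZX c mu v : op_scale (c *: 'X_[mu]) v = c *: mon_act mu v.
Proof.
have [->|c0] := eqVneq c 0.
  by rewrite !scale0r /op_scale msupp0 big_nil.
by rewrite /op_scale (perm_big _ (msuppZ _ c0)) msuppX big_seq1 mcoeffZ mcoeffX eqxx mulr1.
Qed.

Lemma op_scaleX mu v : op_scale 'X_[mu] v = mon_act mu v.
Proof. by rewrite -['X_[mu]]scale1r op_scaleZX scale1r. Qed.

Fact op_scale1 : left_id 1 op_scale.
Proof. by move=> v; rewrite -mpolyX0 op_scaleX mon_act0. Qed.

Fact op_scale_linear P : linear (op_scale P).
Proof.
move=> a v w; rewrite /op_scale scaler_sumr -big_split; apply: eq_bigr => mu _ /=.
by rewrite linearP scalerDr !scalerA mulrC.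
Qed.

HB.instance Definition _ P :=
  GRing.isLinear.Build F V V _ (op_scale P) (op_scale_linear P).

Fact op_scaleDr : right_distributive op_scale +%R.
Proof. by move=> P v w; rewrite linearD. Qed.

Lemma op_scale0l v : op_scale 0 v = 0.
Proof. by rewrite /op_scale msupp0 big_nil. Qed.

Fact op_scaleA P Q v : op_scale P (op_scale Q v) = op_scale (P * Q) v.
Proof.
have sumE (I : Type) (s : seq I) (G : I -> {mpoly F[n]}) :
    op_scale (\sum_(i <- s) G i) v = \sum_(i <- s) op_scale (G i) v.
  exact: (big_morph (op_scale^~ v) (@op_scaleDl v) (op_scale0l v)).
rewrite mpolyME sumE big_allpairs /=.
rewrite {1}/op_scale; apply: eq_bigr => mu _.
rewrite /op_scale linear_sum scaler_sumr; apply: eq_bigr => nu _ /=.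
by rewrite -[RHS]/(op_scale _ _) op_scaleZX mon_actD linearZ scalerA.
Qed.

Let M := opMod x_linear x_comm.

HB.instance Definition _ := GRing.Zmodule.on M.
HB.instance Definition _ := GRing.Zmodule_isLmodule.Build {mpoly F[n]} M
  op_scaleA op_scale1 op_scaleDr op_scaleDl.

Lemma opMod_XE i (m : M) : 'X_i *: m = x i m.
Proof. by rewrite -mon_actU -op_scaleX. Qed.

Lemma opMod_CE c (m : M) : c%:MP *: m = c *: (m : V).
Proof.
by rewrite -[c%:MP]mulr1 -[1]mpolyX0 mul_mpolyC -[RHS]/(c *: (m : V)) -{2}[m]mon_act0 -op_scaleZX.
Qed.

End OpMod.

(* [Q] is [Q_p]: complete, [|p| = 1/p], with [Q] dense. *)
Definition is_Qp (R : realType) (p : nat) (Q : completeField R) :=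
  absv (p%:R : Q) = p%:R^-1 /\
  forall (x : Q) (e : R), 0 < e -> exists q : rat, absv (x - ratr q) < e.

(* [C] is [C_p]: complete, algebraically closed, with the algebraic closure of
   [Q_p] in it dense. *)
Definition is_Cp (R : realType) (Q C : completeField R) (i : {rmorphism Q -> C}) :=
  [/\ forall x, absv (i x) = absv x,
      GRing.closed_field_axiom C &
      forall (x : C) (e : R), 0 < e ->
        exists2 y, algebraicOver i y & absv (x - y) < e].

Record tower (R : realType) := Tower {
  tw_p : nat;
  tw_d : nat;
  Qp : completeField R;
  tw_L : fieldExtType Qp;
  tw_E : splittingFieldType Qp;
  tw_K : completeField R;
  tw_C : completeField R;
  iL : {lrmorphism tw_L -> tw_E};
  iE : {rmorphism tw_E -> tw_K};
  iK : {rmorphism tw_K -> tw_C};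
  tw_prime : prime tw_p;
  tw_Qp : is_Qp tw_p Qp;
  tw_deg : \dim {:tw_L} = tw_d;
  (* [E] is a Galois closure of [L]: it is normal over [Q_p], and no proper
     subfield containing [L] is. *)
  tw_closure : forall F : {subfield tw_E},
    (forall x, iL x \in F) -> normalField 1%AS F -> F = {:tw_E}%AS;
  tw_isom : forall x, absv (iK x) = absv x;
  tw_Cp : is_Cp (iK \o iE \o in_alg tw_E);
  (* the embeddings [L -> C_p], which all have image in [E] *)
  sigma : 'I_tw_d -> {lrmorphism tw_L -> tw_E};
  sigma_inj : forall i j, sigma i =1 sigma j -> i = j;
  sigma_all : forall s : {rmorphism tw_L -> tw_C},
    (forall c : Qp, s c%:A = iK (iE c%:A)) -> exists i, s =1 iK \o iE \o sigma i;
  sigma_id : forall i : 'I_tw_d, i = 0%N :> nat -> sigma i =1 iL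
}.

Section PowerSeries.
Variable F : fieldType.

(* [g(h(T))], for [h] without constant term *)
Definition ps_comp (g h : nat -> F) : nat -> F := fun n =>
  ((\poly_(k < n.+1) g k) \Po (\poly_(k < n.+1) h k))`_n.

End PowerSeries.

Section LubinTate.
Variables (R : realType) (T : tower R).
Local Notation L := (tw_L T).
Local Notation C := (tw_C T).

Definition iLC : L -> C := iK T \o iE T \o iL T.

Definition absL (x : L) : R := absv (iLC x).

Definition is_uniformiser (pi : L) :=
  [/\ pi != 0, absL pi < 1 & forall x, absL x < 1 -> absL x <= absL pi].

(* the residue field of [L] has [q] elements *)
Definition residue_card (q : nat) := exists s : seq L,
  [/\ size s = q, uniq s, forall x, x \in s -> absL x <= 1,
      forall x y, x \in s -> y \in s -> absL (x - y) < 1 -> x = y &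
      forall x, absL x <= 1 -> exists2 y, y \in s & absL (x - y) < 1].

Definition is_frobenius (pi : L) (phi : nat -> L) := exists2 q, residue_card q &
  [/\ phi 0%N = 0, phi 1%N = pi, forall n, absL (phi n) <= 1 &
      forall n, absL (phi n - (n == q)%:R) <= absL pi].

End LubinTate.

Record lubinTate (R : realType) := LubinTate {
  lt_tower :> tower R;
  uniformiser : tw_L lt_tower;
  uniformiserP : is_uniformiser uniformiser;
  phiL : nat -> tw_L lt_tower;
  phiLP : is_frobenius uniformiser phiL
}.

Section LubinTateTheory.
Variables (R : realType) (T : lubinTate R).
Local Notation L := (tw_L T).
Local Notation E := (tw_E T).
Local Notation K := (tw_K T).
Local Notation C := (tw_C T).

(* [[a](T)] is the unique series over [o_L] with linear term [a T] that
   commutes with [phi_L]. *)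
Definition is_bracket (a : L) (g : nat -> L) :=
  [/\ g 0%N = 0, g 1%N = a, forall n, absL (g n) <= 1 &
      ps_comp g (phiL T) =1 ps_comp (phiL T) g].

Definition bracket (a : L) : nat -> L := xget (fun=> 0) [set g | is_bracket a g]%classic.

Definition ps_value (g : nat -> L) (z w : C) := forall e : R, 0 < e ->
  exists N, forall n, (N <= n)%N ->
    absv (\sum_(k < n) iLC (g k) * z ^+ k - w) < e.

(* the points of the open unit disc killed by some iterate of [phi_L] *)
Inductive torsion : C -> Prop :=
| torsion0 : torsion 0
| torsionS z w : absv z < 1 -> ps_value (phiL T) z w -> torsion w -> torsion z.

Definition Linf_pred : {pred C} := fun x =>
  `[< forall S : {pred C}, divring_closed S -> (forall a, iLC a \in S) ->
      (forall z, torsion z -> z \in S) -> x \in S >].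

Fact Linf_divring_closed : divring_closed Linf_pred.
Proof.
split=> [|x y /asboolP hx /asboolP hy|x y /asboolP hx /asboolP hy];
  apply/asboolP => S dS hL ht.
- by case: dS.
- by case: (dS) => _ hB _; apply: hB; [exact: hx|exact: hy].
- by case: (dS) => _ _ hD; apply: hD; [exact: hx|exact: hy].
Qed.

HB.instance Definition _ := GRing.isDivringClosed.Build C Linf_pred Linf_divring_closed.

Record Linf := LinfElt { Linf_val : C; _ : Linf_val \in Linf_pred }.

HB.instance Definition _ := [isSub for Linf_val].
HB.instance Definition _ := [Choice of Linf by <:].
HB.instance Definition _ := [SubChoice_isSubIntegralDomain of Linf by <:].
HB.instance Definition _ := [SubIntegralDomain_isSubField of Linf by <:].

(* [Gamma_L = Gal(L_oo / L)] *)
Record galT := Gal {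
  gal_fun :> {rmorphism Linf -> Linf};
  gal_bij : bijective gal_fun;
  gal_fix : forall (x : Linf) a, val x = iLC a -> gal_fun x = x
}.

Fact gal_id_bij : bijective (idfun : Linf -> Linf).
Proof. by exists id. Qed.

Definition gal_id : galT := @Gal idfun gal_id_bij (fun _ _ _ => erefl).

Fact gal_comp_fix (g h : galT) (x : Linf) a : val x = iLC a -> (g \o h) x = x.
Proof. by move=> xa /=; rewrite !(@gal_fix _ x a). Qed.

Definition gal_comp (g h : galT) : galT :=
  @Gal (g \o h) (bij_comp (gal_bij g) (gal_bij h)) (@gal_comp_fix g h).

(* the Lubin-Tate character, with values in the units of [o_L] *)
Definition chiLT (g : galT) : L := xget 0 [set a | absL a = 1 /\
  forall z : Linf, torsion (val z) ->
    ps_value (bracket a) (val z) (val (g z))]%classic.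

Local Notation RK := (robba K).

Definition seminorm (M : lmodType RK) (q : M -> R) :=
  (forall x y, q (x + y) <= Num.max (q x) (q y)) /\
  (forall c x, q (robbaC c *: x) = absv c * q x).

(* [q] is continuous on the Frechet space of Laurent series converging on
   [r <= |T| < 1], for every [r]. The topology of this space is defined by the
   norms [sup_n |a n| * s ^ n], [r <= s < 1]. *)
Definition LF_continuous (q : RK -> R) := forall r : R, 0 < r -> r < 1 ->
  exists (S : seq R) (c : R), (forall s, s \in S -> r <= s /\ s < 1) /\
    forall f : RK, annulus r (coef f) -> forall b : R, 0 <= b ->
      (forall s n, s \in S -> absv (coef f n) * s ^ n <= b) -> q f <= c * b.

(* The continuous seminorms of the locally convex inductive limit topology. *)
Definition LF_seminorm (q : RK -> R) :=
  seminorm (q : RK^o -> R) /\ LF_continuous q.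

(* The continuous seminorms on a finite free module: for a basis [e], those for
   which every [f |-> q (f *: e i)] is continuous, hence all [f |-> q (f *: m)]. *)
Definition mod_seminorm (M : lmodType RK) (q : M -> R) :=
  seminorm q /\ forall m, LF_continuous (fun f => q (f *: m)).

Definition ps_laurent (g : nat -> L) (n : int) : K :=
  if n is Posz k then iE T (iL T (g k)) else 0.

(* [h] is the substitution [T |-> g(T)]: the continuous [K]-algebra
   endomorphism sending [T] to [g(T)]. *)
Definition is_substitution (g : nat -> L) (h : RK -> RK) :=
  [/\ zmod_morphism h, monoid_morphism h, forall c, h (robbaC c) = robbaC c,
      coef (h (robbaT K)) =1 ps_laurent g &
      forall q, LF_seminorm q -> LF_seminorm (q \o h)].

Definition substitution (g : nat -> L) : RK -> RK :=
  xget (id : RK -> RK) [set h : RK -> RK | is_substitution g h]%classic.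

Definition phiR : RK -> RK := substitution (phiL T).
Definition gammaR (g : galT) : RK -> RK := substitution (bracket (chiLT g)).

(* Equality in [A (x)_(A, s) M] of finite sums of tensors [a (x) m], given as
   sequences of pairs; [a * s b (x) m = a (x) b m]. *)
Section TwistedTensor.
Variables (A : pzRingType) (s : A -> A) (M : lmodType A).

Inductive tensor_eq : seq (A * M) -> seq (A * M) -> Prop :=
| teq_refl x : tensor_eq x x
| teq_sym x y : tensor_eq x y -> tensor_eq y x
| teq_trans x y z : tensor_eq x y -> tensor_eq y z -> tensor_eq x z
| teq_cat x x' y y' : tensor_eq x x' -> tensor_eq y y' ->
    tensor_eq (x ++ y) (x' ++ y')
| teq_catC x y : tensor_eq (x ++ y) (y ++ x)
| teq_0 m : tensor_eq [:: (0, m)] [::]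
| teq_addl a b m : tensor_eq [:: (a + b, m)] [:: (a, m); (b, m)]
| teq_addr a m n : tensor_eq [:: (a, m + n)] [:: (a, m); (a, n)]
| teq_scale a b m : tensor_eq [:: (a * s b, m)] [:: (a, b *: m)].

Definition linearisation (phi : M -> M) (x : seq (A * M)) : M :=
  \sum_(t <- x) t.1 *: phi t.2.

Definition linearisation_iso (phi : M -> M) :=
  (forall m, exists x, linearisation phi x = m) /\
  (forall x y, linearisation phi x = linearisation phi y -> tensor_eq x y).

End TwistedTensor.

Definition finite_free (A : pzRingType) (M : lmodType A) :=
  exists n (e : 'I_n -> M), forall m, exists! c : {ffun 'I_n -> A},
    m = \sum_i c i *: e i.

Record phiGammaModule := PhiGammaModule {
  pg_mod :> lmodType RK;
  pg_free : finite_free pg_mod;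
  pg_gamma : galT -> pg_mod -> pg_mod;
  pg_gamma_id : forall m, pg_gamma gal_id m = m;
  pg_gamma_comp : forall g h m,
    pg_gamma (gal_comp g h) m = pg_gamma g (pg_gamma h m);
  pg_gammaD : forall g m n, pg_gamma g (m + n) = pg_gamma g m + pg_gamma g n;
  pg_gammaZ : forall g a m, pg_gamma g (a *: m) = gammaR g a *: pg_gamma g m;
  (* joint continuity, for the Krull topology on [Gamma_L] *)
  pg_gamma_continuous : forall (g0 : galT) m0 (q : pg_mod -> R), mod_seminorm q ->
    forall e : R, 0 < e ->
    exists (S : seq Linf) (q' : pg_mod -> R) (e' : R), [/\ mod_seminorm q', 0 < e' &
      forall (g : galT) m, (forall x, x \in S -> g x = g0 x) -> q' (m - m0) < e' ->
        q (pg_gamma g m - pg_gamma g0 m0) < e];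
  pg_phi : pg_mod -> pg_mod;
  pg_phiD : forall m n, pg_phi (m + n) = pg_phi m + pg_phi n;
  pg_phiZ : forall a m, pg_phi (a *: m) = phiR a *: pg_phi m;
  pg_phi_gamma : forall g m, pg_phi (pg_gamma g m) = pg_gamma g (pg_phi m);
  pg_phi_iso : linearisation_iso phiR pg_phi
}.

Definition scalK : {rmorphism K -> RK} := @robbaC R K.
Definition scalE : {rmorphism E -> RK} := @robbaC R K \o iE T.
Definition scalL : {rmorphism L -> RK} := @robbaC R K \o iE T \o iL T.

Definition is_exp (x y : L) := forall e : R, 0 < e -> exists N, forall n,
  (N <= n)%N -> absL (\sum_(k < n) x ^+ k / k`!%:R - y) < e.

Section LieAction.
Variable M : phiGammaModule.
Local Notation KM := (resMod scalK M).
Local Notation EM := (resMod scalE M).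
Local Notation LM := (resMod scalL M).

(* The derived action of [Lie(Gamma_L)], identified with [L] through the
   derivative of [chiLT]: [lie xi m] is the derivative at [t = 0], [t] in [Q_p],
   of [exp(t xi) m]. It is an action of an abelian [Q_p]-Lie algebra on the
   [K]-vector space [M]. *)
Record lieAction := LieAction {
  lie :> L -> {linear KM -> KM};
  lieD : forall xi eta m, lie (xi + eta) m = lie xi m + lie eta m;
  lieZ : forall (c : Qp T) xi m, lie (c *: xi) m = iE T c%:A *: lie xi m;
  lieC : forall xi eta m, lie xi (lie eta m) = lie eta (lie xi m);
  lie_derivative : forall xi (m : KM) (q : M -> R), mod_seminorm q ->
    forall e : R, 0 < e -> exists2 r : R, 0 < r &
      forall t : Qp T, t != 0 -> absv t < r ->
      forall g, is_exp (t *: xi) (chiLT g) ->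
        q (iE T (t^-1)%:A *: ((pg_gamma g m : KM) - m) - lie xi m) < e
}.

Variable D : lieAction.

(* [Lie(Gamma_L) x M -> M] is [L]-bilinear. *)
Definition L_analytic :=
  (forall m : M, linear (fun xi : L^o => D xi m : LM)) /\
  (forall xi, linear (fun m : LM => D xi m : LM)).

(* [g_0 = E (x)_(Q_p) Lie(Gamma_L)], with coordinates in a [Q_p]-basis of [L]. *)
Definition g0 := 'rV[E]_(\dim {:L}).

Definition g0_tensor (a : E) (xi : L) : g0 :=
  \row_j (a * (coord (vbasis {:L}) j xi)%:A).

(* the [E]-linear action of [g_0]: [a (x) xi] acts as [a * D xi] *)
Definition g0_act (X : g0) (m : M) : M :=
  \sum_j (iE T (X 0 j) *: (D (vbasis {:L})`_j m : KM)).

(* [nabla] is the [E]-basis of [g_0] with [xi = sum_i (sigma_i xi) nabla_i]. *)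
Definition is_nabla (nabla : 'I_(tw_d T) -> g0) :=
  (forall X : g0, exists! c : {ffun 'I_(tw_d T) -> E}, X = \sum_i c i *: nabla i) /\
  (forall xi, g0_tensor 1 xi = \sum_i sigma i xi *: nabla i).

Variables (nabla : 'I_(tw_d T) -> g0) (f : {linear LM -> LM}).
Hypothesis f_comm : forall X m, f (g0_act X m) = g0_act X (f m).

(* [x_0 = f - 1] and [x_i = nabla_i]; the latter are indexed from 0. *)
Definition koszul_op (i : 'I_(tw_d T).+1) : LM -> LM :=
  if unlift ord0 i is Some j then g0_act (nabla j) else fun m => f m - m.

Lemma g0_act_K (X : g0) : linear (g0_act X : KM -> KM).
Proof.
move=> a m n; rewrite /g0_act scaler_sumr -big_split; apply: eq_bigr => j _ /=.
by rewrite linearP scalerDr !scalerA mulrC.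
Qed.

Lemma g0_act_L (X : g0) : linear (g0_act X : LM -> LM).
Proof. by move=> a m n; have := g0_act_K X (iE T (iL T a)) m n. Qed.

Lemma g0_actD (X : g0) m n : g0_act X (m + n) = g0_act X m + g0_act X n.
Proof. by have := g0_act_K X 1 m n; rewrite !scale1r. Qed.

Lemma g0_actB (X : g0) m n : g0_act X (m - n) = g0_act X m - g0_act X n.
Proof. by have := g0_act_K X (- 1) n m; rewrite !scaleN1r [- n + m]addrC => ->; rewrite addrC. Qed.

Lemma g0_actC (X Y : g0) m : g0_act X (g0_act Y m) = g0_act Y (g0_act X m).
Proof.
rewrite /g0_act; under eq_bigr do rewrite linear_sum scaler_sumr.
rewrite exchange_big; apply: eq_bigr => i _ /=.
rewrite linear_sum scaler_sumr; apply: eq_bigr => j _ /=.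
by rewrite !linearZ /= lieC !scalerA mulrC.
Qed.

Lemma koszul_op_linear i : linear (koszul_op i).
Proof.
rewrite /koszul_op; case: (unlift ord0 i) => [j|]; first exact: g0_act_L.
by move=> a m n; rewrite linearP scalerBr opprD addrACA.
Qed.

Lemma koszul_op_comm i j m :
  koszul_op i (koszul_op j m) = koszul_op j (koszul_op i m).
Proof.
rewrite /koszul_op; case: (unlift ord0 i) (unlift ord0 j) => [i'|] [j'|] //.
- exact: g0_actC.
- by rewrite g0_actB f_comm.
- by rewrite g0_actB f_comm.
Qed.

(* [M] as a module over [A = L[x_0, ..., x_d]] *)
Definition koszulMod : lmodType {mpoly L[(tw_d T).+1]} :=
  opMod koszul_op_linear koszul_op_comm.

(* [C^._{f, L-Lie}(M) = K^.(x_0, x_1, M)] *)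
Definition C_L_Lie : complex {mpoly L[(tw_d T).+1]} :=
  koszul_coh [:: 'X_ord0; 'X_(inord 1)] koszulMod.

(* [C^._{f, Q_p-Lie}(M) = K^.(x_0, ..., x_d, M)] *)
Definition C_Qp_Lie : complex {mpoly L[(tw_d T).+1]} :=
  koszul_coh [seq 'X_i | i <- enum 'I_(tw_d T).+1] koszulMod.

End LieAction.
End LubinTateTheory.

(* Main.v *)
(** On an [L]-analytic module only one [nabla_i] acts non-trivially: writing
    [nabla_i] in the coordinates of a [Q_p]-basis [v_j] of [L], bilinearity gives
    [nabla_i m = (sum_j (nabla_i)_j sigma_1(v_j)) D(1) m], and the matrices
    [(nabla_i)_j] and [sigma_k(v_j)] are inverse to each other.  When [a] acts as
    [0] on [N], the complex [Hom(cone(a : X -> X), N)] splits as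
    [Hom(X, N) (+) Hom(X, N)[-1]]; doing this for [x_2, ..., x_d] produces the
    binomial multiplicities through Pascal's rule.  The isomorphism obtained is
    one of complexes, not only of objects of the derived category. *)
Require Import Defs.
From HB Require Import structures.
From mathcomp Require Import all_boot all_order all_algebra all_field.
From mathcomp Require Import zify.
From mathcomp Require Import reals.
From mathcomp Require Import mpoly.

Set Implicit Arguments.
Unset Strict Implicit.
Unset Printing Implicit Defensive.
Import GRing.Theory.
Local Open Scope ring_scope.

(** * Binomial multiplicities as lists of shifts *)

(** The shifts left after splitting off [k] operators: each one doubles the list into an unshifted
    copy and a copy shifted by one, which is Pascal's rule. *)
Fixpoint binom_seq (k : nat) : seq nat :=
  if k is k'.+1 then binom_seq k' ++ [seq n.+1 | n <- binom_seq k'] else [:: 0%N].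

Lemma count_binom_seq k n : count_mem n (binom_seq k) = 'C(k, n).
Proof.
elim: k n => [|k IH] [|n] //=; rewrite count_cat IH count_map.
  rewrite (eq_count (a2 := pred0)) // count_pred0 addn0.
  by rewrite !bin0.
by rewrite (eq_count (a2 := pred1 n)) // IH binS.
Qed.

(** Both sides contain [n] exactly ['C(k, n)] times. The right side follows the order of the nested
    sum in the theorem. *)
Lemma perm_binom_seq k :
  perm_eq (binom_seq k) (flatten [seq nseq 'C(k, n) n | n <- index_iota 0 k.+1]).
Proof.
apply/allP => n _; apply/eqP; set r := index_iota _ _.
transitivity 'C(k, n); first exact: count_binom_seq.
rewrite count_flatten -map_comp sumnE big_map.
under eq_bigr => m _ do rewrite /= count_nseq /=.
have [nk|kn] := ltnP n k.+1; last first.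
  rewrite bin_small // big1_seq // => m; rewrite mem_index_iota => /andP[_ mk].
  by case: eqP => // mn; move: mk; rewrite mn ltnNge kn.
rewrite (bigD1_seq n) ?iota_uniq ?mem_index_iota //= eqxx mul1n big1 ?addn0 //.
by move=> m /negbTE ->.
Qed.

(** * Isomorphisms of complexes *)

Section ComplexIso.
Variable A : comNzRingType.
Implicit Types X Y Z : complex A.

(** The inverse is only required degreewise as a map of sets: its linearity and its compatibility
    with the differentials follow from those of [f]. *)
Definition ciso X Y := exists (f : forall i, X i -> Y i) (g : forall i, Y i -> X i),
  [/\ forall i, linear (f i),
      forall (i j : int) (e : i + 1 = j) x, f j (df X e x) = df Y e (f i x),
      forall i, cancel (f i) (g i) & forall i, cancel (g i) (f i)].

Lemma ciso_refl X : ciso X X.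
Proof. by exists (fun i => id), (fun i => id); split. Qed.

Lemma ciso_sym X Y : ciso X Y -> ciso Y X.
Proof.
move=> [f [g [lf cf fK gK]]]; exists g, f; split=> // [i a x y|i j e x].
  by apply: (can_inj (fK i)); rewrite lf !gK.
by apply: (can_inj (fK j)); rewrite cf !gK.
Qed.

Lemma ciso_trans Y X Z : ciso X Y -> ciso Y Z -> ciso X Z.
Proof.
move=> [f [g [lf cf fK gK]]] [f' [g' [lf' cf' fK' gK']]].
exists (fun i => f' i \o f i), (fun i => g i \o g' i); split.
- by move=> i a x y /=; rewrite lf lf'.
- by move=> i j e x /=; rewrite cf cf'.
- by move=> i; apply: can_comp.
- by move=> i; apply: can_comp.
Qed.

Lemma cmor_of_linear X Y (f : forall i, X i -> Y i) : (forall i, linear (f i)) ->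
  (forall (i j : int) (e : i + 1 = j) x, f j (df X e x) = df Y e (f i x)) ->
  exists F : cmor X Y, forall i, F i =1 f i.
Proof.
move=> lf cf.
pose F i : {linear X i -> Y i} :=
  HB.pack (f i) (GRing.isLinear.Build A (X i) (Y i) _ (f i) (lf i)).
by exists (@CMor A X Y F cf).
Qed.

(** The two mutually inverse chain maps already give the isomorphism through [dmap], so no formal
    inverse of a quasi-isomorphism appears. *)
Lemma ciso_derived_iso X Y : ciso X Y -> derived_iso X Y.
Proof.
move=> XY; have [f [g [lf cf fK gK]]] := XY.
have [F FE] := cmor_of_linear lf cf.
have lg i : linear (g i) by move=> a x y; apply: (can_inj (fK i)); rewrite lf !gK.
have cg (i j : int) (e : i + 1 = j) x : g j (df Y e x) = df X e (g i x).
  by apply: (can_inj (fK j)); rewrite cf !gK.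
have [G GE] := cmor_of_linear lg cg.
exists (dmap F), (dmap G); split.
  apply: deq_trans (deq_sym (deq_map _ _)) _; apply: deq_ext => i x /=.
  by rewrite GE FE fK.
apply: deq_trans (deq_sym (deq_map _ _)) _; apply: deq_ext => i x /=.
by rewrite FE GE gK.
Qed.

Lemma ciso_dsum X X' Y Y' : ciso X X' -> ciso Y Y' -> ciso (dsum X Y) (dsum X' Y').
Proof.
move=> [f [g [lf cf fK gK]]] [f' [g' [lf' cf' fK' gK']]].
exists (fun i x => (f i x.1, f' i x.2)), (fun i x => (g i x.1, g' i x.2)); split.
- by move=> i a x y /=; rewrite lf lf'.
- by move=> i j e x /=; rewrite /dsum_df cf cf'.
- by move=> i [x y] /=; rewrite fK fK'.
- by move=> i [x y] /=; rewrite gK gK'.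
Qed.

Lemma ciso_dsumC X Y : ciso (dsum X Y) (dsum Y X).
Proof.
exists (fun i x => (x.2, x.1)), (fun i x => (x.2, x.1)).
by split=> // i [].
Qed.

Lemma ciso_dsumA X Y Z : ciso (dsum X (dsum Y Z)) (dsum (dsum X Y) Z).
Proof.
exists (fun i x => ((x.1, x.2.1), x.2.2)), (fun i x => (x.1.1, (x.1.2, x.2))).
split=> //; first by move=> i [? []].
by move=> i [[]].
Qed.

Lemma ciso_dsum0 X : ciso (dsum complex0 X) X.
Proof.
exists (fun i x => x.2), (fun i x => (0, x)).
by split=> // i [x y] /=; rewrite [x]thinmx0.
Qed.

(** * Finite direct sums indexed by lists *)

Definition dsums (F : nat -> complex A) (s : seq nat) :=
  \big[@dsum A/complex0]_(n <- s) F n.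

Lemma ciso_dsums_cat F s t : ciso (dsums F (s ++ t)) (dsum (dsums F s) (dsums F t)).
Proof.
elim: s => [|n s IH] /=; rewrite /dsums ?big_nil ?big_cons.
  exact: ciso_sym (ciso_dsum0 _).
apply: ciso_trans (ciso_dsumA _ _ _).
exact: ciso_dsum (ciso_refl _) IH.
Qed.

(** Permutations are generated by exchanging the first two of three consecutive blocks, so
    commutativity and associativity of [dsum] suffice. *)
Lemma ciso_dsums_perm F s t : perm_eq s t -> ciso (dsums F s) (dsums F t).
Proof.
pose P u := ciso (dsums F s) (dsums F u).
move=> st; apply: (@catCA_perm_ind _ P _ _ _ st); last exact: ciso_refl.
rewrite /P => s1 s2 s3 h; apply: ciso_trans h _; rewrite !catA.
apply: ciso_trans (ciso_dsums_cat _ _ _) _.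
apply: ciso_trans _ (ciso_sym (ciso_dsums_cat _ _ _)).
apply: ciso_dsum (ciso_refl _); apply: ciso_trans (ciso_dsums_cat _ _ _) _.
exact: ciso_trans (ciso_dsumC _ _) (ciso_sym (ciso_dsums_cat _ _ _)).
Qed.

Lemma ciso_dsums_flatten F (c : nat -> nat) s :
  ciso (\big[@dsum A/complex0]_(n <- s) \big[@dsum A/complex0]_(0 <= j < c n) F n)
    (dsums F (flatten [seq nseq (c n) n | n <- s])).
Proof.
elim: s => [|n s IH]; first by rewrite /dsums !big_nil; exact: ciso_refl.
rewrite big_cons /=; apply: ciso_trans _ (ciso_sym (ciso_dsums_cat _ _ _)).
apply: ciso_dsum _ IH; rewrite /dsums; move: (c n) => k.
(* A constant list is the image of any range of length [k]; the induction lets the start of the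
   range vary. *)
have -> : nseq k n = [seq n | _ <- index_iota 0 k].
  by rewrite /index_iota subn0; elim: k (0%N) => //= k IHk m; rewrite -IHk.
by rewrite big_map; exact: ciso_refl.
Qed.

(* Degrees such as [i + n + m] and [i + (n + m)], or [- i + 1] and [- (i - 1)],
   are equal but not convertible. *)
Definition obcast X (i j : int) (e : i = j) : X i -> X j :=
  fun x => eq_rect i (fun k => X k) x j e.

Lemma obcast_linear X i j (e : i = j) : linear (@obcast X i j e).
Proof. by case: j / e. Qed.

Lemma obcast_df X (i i' j j' : int) (ei : i = i') (ej : j = j')
    (e : i + 1 = j) (e' : i' + 1 = j') x :
  obcast ej (df X e x) = df X e' (obcast ei x).
Proof.
case: i' / ei e'; case: j' / ej => e' /=.
by rewrite (eq_irrelevance e e').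
Qed.

Lemma obcastK X i j (e : i = j) (e' : j = i) : cancel (@obcast X i j e) (obcast e').
Proof. by case: j / e e' => e' x; rewrite (eq_irrelevance e' erefl). Qed.

(** * Shifts of complexes and of direct sums *)

Lemma ciso_shift X Y m : ciso X Y -> ciso (shift X m) (shift Y m).
Proof.
move=> [f [g [lf cf fK gK]]].
exists (fun i => f (i + m)), (fun i => g (i + m)); split.
- by move=> i; apply: lf.
- move=> i j e x; rewrite -[RHS]/(_ *: df Y _ (f _ x)) -cf -[RHS]addr0.
  have f0 : f (j + m) 0 = 0.
    by have := lf (j + m) (- 1) 0 0; rewrite scaler0 addr0 scaleN1r addNr.
  by rewrite -[in RHS]f0 -lf addr0.
- by move=> i; apply: fK.
- by move=> i; apply: gK.
Qed.

Lemma ciso_shift_dsum X Y m :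
  ciso (shift (dsum X Y) m) (dsum (shift X m) (shift Y m)).
Proof. by exists (fun i => id), (fun i => id); split. Qed.

Lemma ciso_shift_complex0 m : ciso (shift complex0 m) (@complex0 A).
Proof.
exists (fun i => id), (fun i => id); split=> // i j e x /=.
by rewrite scaler0.
Qed.

Lemma ciso_shift0 X : ciso X (shift X 0).
Proof.
exists (fun i => @obcast X _ _ (esym (addr0 i))), (fun i => @obcast X _ _ (addr0 i)).
split.
- by move=> i; exact: (@obcast_linear X _ _ (esym (addr0 i))).
- by move=> i j e x; rewrite /= scale1r; exact: obcast_df.
- by move=> i; exact: (@obcastK X).
- by move=> i; exact: (@obcastK X).
Qed.

Lemma ciso_shiftD X m n : ciso (shift (shift X m) n) (shift X (n + m)).
Proof.
(* The signs of the differentials agree because [|n + m|] and [|n| + |m|] have the same parity. *)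
have sgn : (-1) ^+ `|n + m| = (-1) ^+ `|n| * (-1) ^+ `|m| :> A.
  by rewrite -exprD -signr_odd -[RHS]signr_odd; congr (_ ^+ nat_of_bool _); lia.
have E i : i + n + m = i + (n + m) by rewrite addrA.
exists (fun i => @obcast X _ _ (E i)), (fun i => @obcast X _ _ (esym (E i))); split.
- by move=> i; exact: (@obcast_linear X _ _ (E i)).
- move=> i j e x; rewrite /= scalerA -sgn.
  have E0 : obcast (E j) (0 : X (j + n + m)) = 0 by case: _ / (E j).
  rewrite -[X in obcast _ X]addr0 obcast_linear E0 addr0; congr (_ *: _).
  exact: obcast_df.
- by move=> i; exact: (@obcastK X).
- by move=> i; exact: (@obcastK X).
Qed.

Lemma ciso_shift_dsums X s :
  ciso (shift (dsums (fun n => shift X (- n%:Z)) s) (- 1))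
    (dsums (fun n => shift X (- n%:Z)) [seq n.+1 | n <- s]).
Proof.
elim: s => [|n s IH]; rewrite /dsums /= ?big_nil ?big_cons.
  exact: ciso_shift_complex0.
apply: ciso_trans (ciso_shift_dsum _ _ _) _; apply: ciso_dsum IH.
have -> : - n.+1%:Z = - 1 + - n%:Z by lia.
exact: ciso_shiftD.
Qed.

(** * Hom from the cone of an operator acting as zero on the target *)

Lemma hom_appD (U V : lmodType A) (h : Defs.hom U V) x y : h (x + y) = h x + h y.
Proof. by have := hom_linear h 1 x y; rewrite !scale1r. Qed.

Lemma hom_app0 (U V : lmodType A) (h : Defs.hom U V) : h 0 = 0.
Proof. by have := hom_linear h (- 1) 0 0; rewrite scaler0 addr0 scaleN1r addNr. Qed.

Lemma hom_appZ (U V : lmodType A) (h : Defs.hom U V) b x : h (b *: x) = b *: h x.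
Proof. by rewrite -[b *: x]addr0 hom_linear hom_app0 addr0. Qed.

Lemma hom_appN (U V : lmodType A) (h : Defs.hom U V) x : h (- x) = - h x.
Proof. by rewrite -scaleN1r hom_appZ scaleN1r. Qed.

Section HomCone.
Variables (N : lmodType A) (a : A).
Hypothesis aN0 : forall m : N, a *: m = 0.

(** The cross term [a *: x.1] of the cone differential is sent by [h] to a multiple of [a] in [N],
    hence to 0. The proof [e1] is arbitrary so that the formula applies in any degree without
    transport. *)
Lemma hom_cone_df X (i j : int) (e : i + 1 = j) (e1 : i + 1 + 1 = j + 1)
    (h : Defs.hom (cone (cscale a X) j) N) x :
  h (df (cone (cscale a X)) e x) = h (- df X e1 x.1, df X e x.2).
Proof.
case: j / e e1 h => e1 h /=; rewrite (eq_irrelevance e1 erefl).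
have -> : (- df X erefl x.1, a *: x.1 + df X erefl x.2) =
  a *: ((0, x.1) : X (i + 1 + 1)%R * X (i + 1)%R)%type +
  (- df X erefl x.1, df X erefl x.2).
  by congr (_, _); rewrite /= ?scaler0 ?add0r.
by rewrite hom_linear aN0 add0r.
Qed.

(** A map out of [X (- i + 1) * X (- i)] is the pair of its restrictions to the factors. As
    [- i + 1 = - (i - 1)], the restriction to the first factor lies in degree [i - 1] of [homC X N],
    whence the shift by [- 1]. *)
Lemma ciso_hom_cone X :
  ciso (homC (cone (cscale a X)) N) (dsum (homC X N) (shift (homC X N) (- 1))).
Proof.
have E (i : int) : - i + 1 = - (i - 1) by rewrite opprD opprK.
have lin2 i (h : Defs.hom (X (- i + 1)%R * X (- i)%R)%type N) :
    linear (fun x => h (0, x)).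
  move=> b x y; rewrite -hom_linear; congr (h (_, _)).
  by rewrite /= scaler0 addr0.
have lin1 i (h : Defs.hom (X (- i + 1)%R * X (- i)%R)%type N) :
    linear (fun x : X (- (i - 1)) => h (obcast (esym (E i)) x, 0)).
  move=> b x y; rewrite -hom_linear obcast_linear; congr (h (_, _)).
  by rewrite /= scaler0 addr0.
have linI i (h : (Defs.hom (X (- i)%R) N * Defs.hom (X (- (i - 1))%R) N)%type) :
    linear (fun x : (X (- i + 1)%R * X (- i)%R)%type =>
      h.2 (obcast (E i) x.1) + h.1 x.2).
  by move=> b x y /=; rewrite obcast_linear !hom_linear scalerDr addrACA.
exists (fun i h => (Defs.Hom (lin2 i h), Defs.Hom (lin1 i h))),
  (fun i h => Defs.Hom (linI i h)).
split.
- by move=> i b h h'; congr (_, _); apply: hom_eq.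
- move=> i j e h; congr (_, _); apply: hom_eq => x /=.
    rewrite (hom_cone_df _ (congr1 (fun k => k + 1) (hom_eqi e))) /=.
    by rewrite linear0 oppr0.
  (* On the first factor the cone differential is minus that of [X], which matches the sign in the
     differential of the shift by [- 1]. *)
  rewrite (hom_cone_df _ (congr1 (fun k => k + 1) (hom_eqi e))) /= linear0.
  rewrite expr1 scaleN1r -hom_appN; congr (h (_, _)); rewrite ?oppr0 //=.
  congr (- _); symmetry; exact: obcast_df.
- move=> i h; apply: hom_eq => -[x y] /=; rewrite obcastK -hom_appD.
  by congr (h (_, _)); rewrite /= ?addr0 ?add0r.
- move=> i [h h']; congr (_, _); apply: hom_eq => x /=; last first.
    by rewrite obcastK hom_app0 addr0.
  have -> : obcast (E i) (0 : X (- i + 1)) = 0 by case: _ / (E i).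
  by rewrite hom_app0 add0r.
Qed.

End HomCone.

(** Induction removes operators from the right end: [koszul] is a left fold, so the last operator
    gives the outermost cone, and [ciso_hom_cone] applies to it. *)
Lemma ciso_koszul_coh_zero (N : lmodType A) (s t : seq A) :
  (forall a, a \in t -> forall m : N, a *: m = 0) ->
  ciso (koszul_coh (s ++ t) N)
    (dsums (fun n => shift (koszul_coh s N) (- n%:Z)) (binom_seq (size t))).
Proof.
elim/last_ind: t => [_|t a IH t0].
  rewrite cats0 /dsums big_cons big_nil; apply: ciso_trans (ciso_shift0 _) _.
  exact: ciso_trans (ciso_sym (ciso_dsum0 _)) (ciso_dsumC _ _).
rewrite size_rcons /= -rcons_cat /koszul_coh {1}/koszul foldl_rcons.
apply: ciso_trans (ciso_hom_cone _ _) _.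
  by apply: t0; rewrite mem_rcons mem_head.
apply: ciso_trans _ (ciso_sym (ciso_dsums_cat _ _ _)).
have IHt : ciso (koszul_coh (s ++ t) N)
    (dsums (fun n => shift (koszul_coh s N) (- n%:Z)) (binom_seq (size t))).
  by apply: IH => b bt; apply: t0; rewrite mem_rcons in_cons bt orbT.
apply: (ciso_dsum IHt).
exact: ciso_trans (ciso_shift _ IHt) (ciso_shift_dsums _ _).
Qed.

End ComplexIso.

(** Separates the indices of the two variables kept in [C_L_Lie], with the second written [inord 1]
    as there, from the list [t] of those to be split off. *)
Lemma enum_ord_ge2 n : (0 < n)%N -> exists2 t : seq 'I_n.+1,
  enum 'I_n.+1 = [:: ord0, inord 1 & t] &
  size t = n.-1 /\ forall i, i \in t -> (1 < i)%N.
Proof.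
case: n => // n _; exists [seq lift ord0 (lift ord0 i) | i <- enum 'I_n].
  rewrite !enum_ordSl /= -map_comp; congr [:: _, _ & _].
  by apply: val_inj; rewrite /= inordK.
split=> [|_ /mapP[i _ ->] //]; by rewrite size_map size_enum_ord.
Qed.

(** * The action of the [nabla i] on an analytic module *)

Section Analytic.
Variables (R : realType) (T : lubinTate R) (M : phiGammaModule T) (D : lieAction M).
Hypothesis M_analytic : L_analytic D.
Variable nabla : 'I_(tw_d T) -> g0 T.
Hypothesis nablaP : is_nabla nabla.

Local Notation v j := ((vbasis {:tw_L T})`_j).

Lemma g0_tensor_basis (j : 'I_(\dim {:tw_L T})) : g0_tensor 1 (v j) = delta_mx 0 j.
Proof.
apply/rowP => k; rewrite !mxE mul1r coord_free ?(basis_free (vbasisP _)) //=.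
by rewrite [k == j]eq_sym; case: (j == k); rewrite ?scale1r ?scale0r.
Qed.

(** Write [nabla i] in the basis of the tensors of 1 with [v j], then expand each tensor in the
    [nabla l]. Coordinates in the latter basis are unique, so comparison with the trivial expansion
    of [nabla i] gives the identity. *)
Lemma nabla_sigma i k :
  \sum_j nabla i 0 j * sigma k (v j) = (k == i)%:R.
Proof.
have [uniq_coord nablaE] := nablaP.
have [c [_ cU]] := uniq_coord (nabla i).
have h1 := cU [ffun k => \sum_j nabla i 0 j * sigma k (v j)].
have h2 := cU [ffun k => (k == i)%:R].
suff /ffunP/(_ k) : [ffun k => \sum_j nabla i 0 j * sigma k (v j)]
    = [ffun k => (k == i)%:R] :> {ffun 'I_(tw_d T) -> tw_E T} by rewrite !ffunE.
rewrite -h1 ?h2 //.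
  rewrite (bigD1 i) //= ffunE eqxx scale1r big1 ?addr0 // => l /negbTE li.
  by rewrite ffunE li scale0r.
rewrite [LHS]row_sum_delta.
under eq_bigr do rewrite -g0_tensor_basis nablaE scaler_sumr.
rewrite exchange_big; apply: eq_bigr => l _ /=.
by rewrite ffunE scaler_suml; apply: eq_bigr => j _; rewrite scalerA.
Qed.

Lemma lie_analytic xi (m : M) :
  D xi m = iE T (iL T xi) *: (D 1 m : resMod (scalK T) M).
Proof.
have [linD _] := M_analytic; have /= := linD m xi 1 0.
(* Additivity alone gives this; it removes the additive term from the linearity identity at
   [xi * 1 + 0]. *)
have D0 : D 0 m = 0.
  have := lieD D 0 0 m; rewrite addr0 => /eqP.
  by rewrite -[X in X == _]addr0 (inj_eq (addrI _)) => /eqP <-.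
by rewrite addr0 D0 addr0 -[xi *: _]/(xi * 1) mulr1.
Qed.

Lemma nabla_act i (m : M) :
  g0_act D (nabla i) m = (i == 0%N :> nat)%:R *: (D 1 m : resMod (scalK T) M).
Proof.
have dT : (0 < tw_d T)%N := leq_ltn_trans (leq0n i) (ltn_ord i).
(* The index of the identity embedding: [sigma k] is [iL], so the scalar acting on [D 1 m] becomes
   the sum in [nabla_sigma]. *)
pose k := Ordinal dT.
have -> : (i == 0%N :> nat)%:R = iE T (k == i)%:R by rewrite rmorph_nat eq_sym.
rewrite /g0_act; under eq_bigr do rewrite lie_analytic scalerA -rmorphM.
rewrite -scaler_suml -rmorph_sum -(nabla_sigma i k).
apply: (congr1 (fun c => iE T c *: (D 1 m : resMod (scalK T) M))).
by apply: eq_bigr => j _; rewrite (sigma_id (i := k)).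
Qed.

End Analytic.

Theorem theorem1p1 (R : realType) (T : lubinTate R)
    (M : phiGammaModule T) (D : lieAction M) (M_analytic : L_analytic D)
    (nabla : 'I_(tw_d T) -> g0 T) (nablaP : is_nabla nabla)
    (f : {linear resMod (scalL T) M -> resMod (scalL T) M})
    (f_comm : forall (X : g0 T) (m : M), f (g0_act D X m) = g0_act D X (f m)) :
  derived_iso (C_Qp_Lie nabla f_comm)
    (\big[@dsum _/complex0]_(0 <= n < tw_d T)
       \big[@dsum _/complex0]_(0 <= j < 'C((tw_d T).-1, n))
         shift (C_L_Lie nabla f_comm) (- n%:Z)).
Proof.
(* Positivity of the degree ensures that the variable of index 1 exists and that [(tw_d T).-1.+1] is
   [tw_d T]. *)
have d0 : (0 < tw_d T)%N by rewrite -tw_deg; exact: (adim_gt0 {:tw_L T}%AS).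
have [t enumE [size_t t_ge2]] := enum_ord_ge2 d0.
apply: ciso_derived_iso; rewrite /C_Qp_Lie enumE /=.
have t0 a : a \in [seq 'X_i | i <- t] ->
    forall m : koszulMod nabla f_comm, a *: m = 0.
  case/mapP => i /t_ge2 i2 -> m; rewrite opMod_XE /koszul_op.
  (* The variable of index [i] acts as [nabla j] with [i = j + 1], so [i > 1] means [j > 0], where
     [nabla_act] gives zero. *)
  have /unlift_some[j ij ->] : ord0 != i by rewrite -val_eqE /=; lia.
  rewrite nabla_act // [_ == _](_ : _ = false) ?scale0r //.
  by apply/negbTE; move: i2; rewrite ij lift0; lia.
apply: ciso_trans (ciso_koszul_coh_zero [:: _; _] t0) _.
(* Both sides are now sums of shifts of [C_L_Lie] over lists, which it remains to compare up to
   permutation. *)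
apply: ciso_trans _ (ciso_sym (ciso_dsums_flatten _ (fun n => 'C((tw_d T).-1, n)) _)).
apply: ciso_dsums_perm; rewrite size_map size_t -[in index_iota _ _](prednK d0).
exact: perm_binom_seq.
Qed.
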